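(* Let $n \geq 1$ and fix $\lambda^{(1)},\lambda^{(2)},\lambda^{(3)} \in \{1,2,3\}^n$; write $\boldsymbol{\lambda}=(\lambda^{(1)},\lambda^{(2)},\lambda^{(3)})$. Then the following four sets are in bijection: (1) the set $\mathcal{T}_{3,n}(\boldsymbol{\lambda})$ of interlacing triangular arrays of rank $3$ and height $n$ with top row $\boldsymbol{\lambda}$; (2) the set $\mathcal{P}_n(\boldsymbol{\lambda})$ of $1/2/3$-puzzles with boundary conditions $\boldsymbol{\lambda}$; (3) the set $\widetilde{\mathcal{P}}_n(\boldsymbol{\xi})$ of $0/1/10$-puzzles with boundary conditions $\boldsymbol{\xi}=\mathsf{str}(\boldsymbol{\lambda})$; (4) the set $\mathcal{C}_n(\boldsymbol{\kappa})$ of proper vertex colorings of $\Delta_n$ by $\{0,1,2,3\}$, with base point colored $0$, and with boundary colors $\boldsymbol{\kappa}=\mathsf{col}(\boldsymbol{\lambda})$.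
   Context: **Interlacing triangular arrays.** An interlacing triangular array $T$ of rank $m$ and height $n$ is a collection $\{T^{(i)}_{j,k} : 1\le i\le m,\ 1\le j\le k\le n\}$ of elements of $\{1,\dots,m\}$ such that: (a) for each $k=1,\dots,n$, the multiset $\{T^{(i)}_{j,k} : 1\le i\le m,\ 1\le j\le k\}$ contains each of $1,\dots,m$ exactly $k$ times; (b) let $h(i,j,k)=in+j-(n+k)/2$. If $T^{(i)}_{j,k}=T^{(i')}_{j',k}=a$ with $h(i,j,k)<h(i',j',k)$, then there exist $i'',j''$ with $T^{(i'')}_{j'',k-1}=a$ and $h(i,j,k)<h(i'',j'',k-1)<h(i',j',k)$. $T^{(i)}$ is the $i$-th triangle, and $T^{(i)}_{\bullet,k}=(T^{(i)}_{1,k},\dots,T^{(i)}_{k,k})$ is its $k$-th row. $\mathcal{T}_{m,n}(\lambda^{(1)},\dots,\lambda^{(m)})$ is the set of such arrays with $T^{(i)}_{\bullet,n}=\lambda^{(i)}$ for all $i$ (the ''top row''). **Triangular grid.** $\Delta_n$ is the triangular grid graph of side length $n$: an upward-pointing equilateral triangle of side $n$ subdivided into $n^2$ unit triangles, with $\binom{n+2}{2}$ vertices, embedded in the plane with a horizontal bottom side. Its faces are the unit triangles, each $\Delta$-oriented (pointing up) or $\nabla$-oriented (pointing down). The base point is the lower left corner. Boundary edges are read clockwise from the base point: left side (bottom to top), right side (top to bottom), bottom side (right to left), giving three strings of length $n$, called the boundary conditions of an edge labeling. Every edge has one of three directions: parallel to the left side, parallel to the right side, or horizontal. **$1/2/3$-puzzles.**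 A $1/2/3$-puzzle is a labeling of the edges of $\Delta_n$ by $1,2,3$ such that the three edges of each face have distinct labels. $\mathcal{P}_n(\boldsymbol{\lambda})$ is the set of these with boundary conditions $\boldsymbol{\lambda}$. **$0/1/10$-puzzles.** A $0/1/10$-puzzle is a labeling of the edges of $\Delta_n$ by the symbols $0,1,10$ such that each $\Delta$-oriented face has (left edge, right edge, bottom edge) labeled by one of $(0,0,0)$, $(1,1,1)$, $(0,10,1)$, $(1,0,10)$, $(10,1,0)$, $(10,10,10)$, and each $\nabla$-oriented face is labeled by a $180^\circ$ rotation of one of these. $\widetilde{\mathcal{P}}_n(\boldsymbol{\xi})$ is the set of these with boundary conditions $\boldsymbol{\xi}=(\xi^{(1)},\xi^{(2)},\xi^{(3)})$, $\xi^{(i)}\in\{0,1,10\}^n$. **The map $\mathsf{str}$.** $\mathsf{str}(\lambda^{(1)},\lambda^{(2)},\lambda^{(3)})=(\xi^{(1)},\xi^{(2)},\xi^{(3)})$ is obtained by replacing letters entrywise: in $\lambda^{(1)}$: $2\mapsto 0,\ 3\mapsto 1,\ 1\mapsto 10$; in $\lambda^{(2)}$: $1\mapsto 0,\ 2\mapsto 1,\ 3\mapsto 10$; in $\lambda^{(3)}$: $3\mapsto 0,\ 1\mapsto 1,\ 2\mapsto 10$. **Colorings and $\mathsf{col}$.** $\mathcal{C}_n$ is the set of proper colorings of the vertices of $\Delta_n$ by $\{0,1,2,3\}$ with the base point colored $0$. $\mathcal{C}_n(\boldsymbol{\kappa})$ is the subset with a prescribed coloring $\boldsymbol{\kappa}$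 of the boundary vertices. To an edge with endpoints of different colors $c,c'$ assign a label in $\{1,2,3\}$: if $0\in\{c,c'\}$ the label is the nonzero one of the two; otherwise it is the unique element of $\{1,2,3\}\setminus\{c,c'\}$. $\mathsf{col}(\boldsymbol{\lambda})$ is the (necessarily unique if it exists) coloring of the boundary vertices of $\Delta_n$ with base point colored $0$ and adjacent boundary vertices colored differently, such that the boundary edges receive the labels $\boldsymbol{\lambda}$ under this rule. If no such boundary coloring exists, $\mathcal{C}_n(\mathsf{col}(\boldsymbol{\lambda}))$ is understood to be empty. *)

(* Defs.v *)
From HB Require Import structures.
From mathcomp Require Import all_boot all_order all_algebra.

Set Implicit Arguments.
Unset Strict Implicit.
Unset Printing Implicit Defensive.

Import Order.TTheory GRing.Theory Num.Theory.

(* Indices and letters that run over 1, ..., m in the mathematics are 0-based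
   here: i : 'I_m stands for i + 1. *)

Definition in_bijection (T U : finType) (A : {set T}) (B : {set U}) : Prop :=
  exists f : {x : T | x \in A} -> {y : U | y \in B}, bijective f.

Section Arrays.
Variables m n : nat.

(* (i, (j, k)) is the position of T^(i+1)_(j+1, k+1). *)
Definition pos : finType :=
  ('I_m * {jk : 'I_n * 'I_n | (jk.1 <= jk.2)%N})%type.

Implicit Types p q r : pos.

Definition tri p : 'I_m := p.1.
Definition col_of p : 'I_n := (val p.2).1.
Definition row_of p : 'I_n := (val p.2).2.

Definition h p : rat :=
  let i := (tri p).+1 in let j := (col_of p).+1 in let k := (row_of p).+1 in
  (i%:R * n%:R + j%:R - (n%:R + k%:R) / 2%:R)%R.

Definition array : finType := {ffun pos -> 'I_m}.

Definition balanced (T : array) : bool :=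
  [forall k : 'I_n, forall a : 'I_m,
    #|[set p | row_of p == k & T p == a]| == k.+1].

Definition interlacing (T : array) : bool :=
  [forall p, forall q,
    [&& row_of p == row_of q, T p == T q & (h p < h q)%R] ==>
    [exists r, [&& (row_of r).+1 == row_of p, T r == T p
                 & (h p < h r < h q)%R]]].

Definition top_row (lam : 'I_m -> n.-tuple 'I_m) (T : array) : bool :=
  [forall p, ((row_of p).+1 == n) ==> (T p == tnth (lam (tri p)) (col_of p))].

Definition interlacing_arrays (lam : 'I_m -> n.-tuple 'I_m) : {set array} :=
  [set T | [&& balanced T, interlacing T & top_row lam T]].

End Arrays.

(* The vertex (x, y) of the grid of side n, x + y <= n, is the point reached
   from the base point by x unit steps along the bottom side and y unit steps
   along the left side. The upward face (x, y), x + y < n, has corners (x, y),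
   (x, y + 1), (x + 1, y); the downward face (x, y), x + y < n - 1, has corners
   (x + 1, y), (x, y + 1), (x + 1, y + 1). *)
Definition cell (n : nat) : finType :=
  {p : 'I_n * 'I_n | (p.1 + p.2 < n)%N}.

Definition xc n (c : cell n) : nat := (val c).1.
Definition yc n (c : cell n) : nat := (val c).2.

Definition mkcell n (x y : nat) (h : (x + y < n)%N) : cell n :=
  exist (fun p : 'I_n * 'I_n => (p.1 + p.2 < n)%N)
    (Ordinal (leq_ltn_trans (leq_addr y x) h),
     Ordinal (leq_ltn_trans (leq_addl x y) h)) h.

Lemma cellP n (c : cell n) : (xc c + yc c < n)%N.
Proof. exact: valP c. Qed.

Definition vertex n := cell n.+1.
Definition up_face n := cell n.
Definition down_face n := cell n.-1.

Definition Left : 'I_3 := @Ordinal 3 0 isT.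
Definition Right : 'I_3 := @Ordinal 3 1 isT.
Definition Bottom : 'I_3 := @Ordinal 3 2 isT.

(* Every edge lies on exactly one upward face: (d, f) is the left, right or
   bottom edge of f. *)
Definition edge n : finType := ('I_3 * up_face n)%type.

Section Grid.
Variable n : nat.

Lemma corner0_subproof (f : up_face n) : (xc f + yc f < n.+1)%N.
Proof. exact: ltnW (cellP f). Qed.
Lemma cornerx_subproof (f : up_face n) : ((xc f).+1 + yc f < n.+1)%N.
Proof. exact: cellP f. Qed.
Lemma cornery_subproof (f : up_face n) : (xc f + (yc f).+1 < n.+1)%N.
Proof. by rewrite addnS ltnS; exact: cellP f. Qed.

Definition corner0 (f : up_face n) : vertex n := mkcell (corner0_subproof f).
Definition cornerx (f : up_face n) : vertex n := mkcell (cornerx_subproof f).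
Definition cornery (f : up_face n) : vertex n := mkcell (cornery_subproof f).

Definition ends (e : edge n) : vertex n * vertex n :=
  let: (d, f) := e in
  if d == Left then (corner0 f, cornery f)
  else if d == Right then (cornery f, cornerx f)
  else (cornerx f, corner0 f).

Lemma down0_subproof (g : down_face n) : (xc g + yc g < n)%N.
Proof. exact: leq_trans (cellP g) (leq_pred n). Qed.
Lemma downx_subproof (g : down_face n) : ((xc g).+1 + yc g < n)%N.
Proof. by rewrite addSn -ltn_predRL; exact: cellP g. Qed.
Lemma downy_subproof (g : down_face n) : (xc g + (yc g).+1 < n)%N.
Proof. by rewrite addnS -ltn_predRL; exact: cellP g. Qed.

Definition up_edges (f : up_face n) : edge n * edge n * edge n :=
  ((Left, f), (Right, f), (Bottom, f)).

(* The right, left and top edges of g, i.e. the edges which a rotation by 180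
   degrees takes to the left, right and bottom edges of an upward face. *)
Definition down_edges (g : down_face n) : edge n * edge n * edge n :=
  ((Left, mkcell (downx_subproof g)),
   (Right, mkcell (down0_subproof g)),
   (Bottom, mkcell (downy_subproof g))).

Lemma bleft_subproof (i : 'I_n) : (0 + i < n)%N.
Proof. exact: ltn_ord i. Qed.
Lemma bright_subproof (i : 'I_n) : (i + rev_ord i < n)%N.
Proof. by rewrite /= -addSn subnKC. Qed.
Lemma bbottom_subproof (i : 'I_n) : (rev_ord i + 0 < n)%N.
Proof. by rewrite addn0; exact: ltn_ord. Qed.

(* The i-th edge of side s, the boundary being read clockwise from the base
   point; note that rev_ord i = n - 1 - i. *)
Definition bedge (s : 'I_3) (i : 'I_n) : edge n :=
  (s, if s == Left then mkcell (bleft_subproof i)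
      else if s == Right then mkcell (bright_subproof i)
      else mkcell (bbottom_subproof i)).

Definition has_boundary (L : finType) (lam : 'I_3 -> n.-tuple L)
    (P : {ffun edge n -> L}) : bool :=
  [forall s : 'I_3, forall i : 'I_n, P (bedge s i) == tnth (lam s) i].

End Grid.

Section Puzzles123.
Variable n : nat.

Definition distinct_labels (P : {ffun edge n -> 'I_3})
    (t : edge n * edge n * edge n) : bool :=
  let: (e1, e2, e3) := t in uniq [:: P e1; P e2; P e3].

Definition puzzles123 (lam : 'I_3 -> n.-tuple 'I_3) :
    {set {ffun edge n -> 'I_3}} :=
  [set P | [&& [forall f, distinct_labels P (up_edges f)],
               [forall g, distinct_labels P (down_edges g)]
             & has_boundary lam P]].

End Puzzles123.

Inductive symbol := S0 | S1 | S10.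

Definition symbol_code (x : symbol) : option bool :=
  match x with S0 => Some false | S1 => Some true | S10 => None end.
Definition symbol_decode (o : option bool) : symbol :=
  match o with Some false => S0 | Some true => S1 | None => S10 end.
Lemma symbol_codeK : cancel symbol_code symbol_decode.
Proof. by case. Qed.

HB.instance Definition _ := Finite.copy symbol (can_type symbol_codeK).

Section Puzzles0110.
Variable n : nat.

Definition allowed_faces : seq (symbol * symbol * symbol) :=
  [:: (S0, S0, S0); (S1, S1, S1); (S0, S10, S1);
      (S1, S0, S10); (S10, S1, S0); (S10, S10, S10)].

Definition allowed_labels (P : {ffun edge n -> symbol})
    (t : edge n * edge n * edge n) : bool :=
  let: (e1, e2, e3) := t in (P e1, P e2, P e3) \in allowed_faces.

Definition puzzles0110 (xi : 'I_3 -> n.-tuple symbol) :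
    {set {ffun edge n -> symbol}} :=
  [set P | [&& [forall f, allowed_labels P (up_edges f)],
               [forall g, allowed_labels P (down_edges g)]
             & has_boundary xi P]].

(* The successors restore the 1-based superscript and letter. *)
Definition str_letter (s a : 'I_3) : symbol :=
  match s.+1, a.+1 with
  | 1, 2 => S0 | 1, 3 => S1 | 1, _ => S10
  | 2, 1 => S0 | 2, 2 => S1 | 2, _ => S10
  | _, 3 => S0 | _, 1 => S1 | _, _ => S10
  end.

Definition str_map (lam : 'I_3 -> n.-tuple 'I_3) : 'I_3 -> n.-tuple symbol :=
  fun s => map_tuple (str_letter s) (lam s).

End Puzzles0110.

Section Colorings.
Variable n : nat.

Definition base_point : vertex n := @mkcell n.+1 0 0 (ltn0Sn n).

Definition coloring : finType := {ffun vertex n -> 'I_4}.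

Definition proper_colorings : {set coloring} :=
  [set c : {ffun vertex n -> 'I_4} | (c base_point == ord0) &&
           [forall e : edge n, c (ends e).1 != c (ends e).2]].

Definition on_boundary (v : vertex n) : bool :=
  [|| xc v == 0, yc v == 0 | xc v + yc v == n].

Definition bvertex : finType := {v : vertex n | on_boundary v}.

Definition bcoloring : finType := {ffun bvertex -> 'I_4}.

Definition colorings_on (kappa : bcoloring) : {set coloring} :=
  [set c : {ffun vertex n -> 'I_4} in proper_colorings |
     [forall v : bvertex, c (val v) == kappa v]].

(* An edge with end colors c != c' has label a. The letter a is lift ord0 a
   when viewed as a nonzero color. *)
Definition edge_label (c c' : 'I_4) (a : 'I_3) : bool :=
  (c != c') &&
  (if ord0 \in [:: c; c'] then lift ord0 a \in [:: c; c']
   else lift ord0 a \notin [:: c; c']).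

Definition is_col (lam : 'I_3 -> n.-tuple 'I_3) (kappa : bcoloring) : bool :=
  [forall v : bvertex, (val v == base_point) ==> (kappa v == ord0)] &&
  [forall s : 'I_3, forall i : 'I_n, forall u : bvertex, forall v : bvertex,
     (ends (bedge s i) == (val u, val v)) ==>
     edge_label (kappa u) (kappa v) (tnth (lam s) i)].

(* None when no such boundary coloring exists; otherwise it is unique. *)
Definition col_map (lam : 'I_3 -> n.-tuple 'I_3) : option bcoloring :=
  [pick kappa | is_col lam kappa].

Definition colorings (kappa : option bcoloring) : {set coloring} :=
  if kappa is Some k then colorings_on k else set0.

End Colorings.

(* Main.v *)
(* For two consecutive rows of an array, read the two rows merged in the order
   of h.  Balance and interlacing say exactly that each letter alternates
   between the upper and the lower row, starting and ending in the upper row;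
   equivalently, the set S of letters whose last occurrence was in the upper row
   evolves from the empty set to the full set, each upper letter being new and
   each lower letter being present.  In the first triangle |S| alternates
   between 0 and 1, which forces the lower row to be the upper row without its
   last letter; in the third triangle |S| alternates between 2 and 3, which
   forces the lower row to be the upper row without its first letter.  In the
   second triangle S alternates between {x} and the complement of {y}, and the
   letters x and y are the labels met when crossing a strip of a 1/2/3-puzzle
   between two lines parallel to the right side.  So a puzzle corresponds to the
   array whose second triangle lists the labels parallel to the right side, and
   whose first and third triangles list initial segments of the left boundary
   and final segments of the bottom boundary.

   Replacing letters direction by direction turns 1/2/3-puzzles into
   0/1/10-puzzles.  With the colors seen as the Klein four-group, the label of
   an edge is the difference of its end colors, and three labels around a face
   are distinct exactly when they are nonzero and sum to zero; hence puzzles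
   are the differences of the proper colorings. *)
Require Import Defs.
From mathcomp Require Import all_boot all_order all_algebra.
From mathcomp Require Import zify lra.

Set Implicit Arguments.
Unset Strict Implicit.
Unset Printing Implicit Defensive.

Import Order.TTheory GRing.Theory Num.Theory.

(** * Bijections between finite sets *)

Lemma in_bijectionP (T U : finType) (A : {set T}) (B : {set U}) (f : T -> U) :
    {in A, forall x, f x \in B} -> {in A &, injective f} ->
    {in B, forall y, exists2 x, x \in A & f x = y} ->
  in_bijection A B.
Proof.
move=> fAB f_inj f_surj.
exists (fun x : {x | x \in A} => exist _ (f (val x)) (fAB _ (valP x))).
apply: inj_card_bij => [[x xA] [y yA] [/f_inj fxy]|].
  by apply: val_inj; apply: fxy.
rewrite !card_sig.
rewrite -(card_in_imset f_inj) subset_leq_card //.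
apply/subsetP=> y /f_surj [x xA <-]; exact: imset_f.
Qed.

Lemma in_bijection_sym (T U : finType) (A : {set T}) (B : {set U}) :
  in_bijection A B -> in_bijection B A.
Proof. by case=> f [g fK gK]; exists g; exists f. Qed.

Lemma in_bijection_trans (T U V : finType)
    (A : {set T}) (B : {set U}) (C : {set V}) :
  in_bijection A B -> in_bijection B C -> in_bijection A C.
Proof. by case=> f f_bij [g g_bij]; exists (g \o f); apply: bij_comp. Qed.

(** * Alternation of letters between two rows *)

Section Alternation.
Variable A : finType.
Implicit Types (a : A) (s : bool) (S : {set A}) (M : seq (A * bool)).

(* s tells whether the last occurrence of a before M was in the upper row. *)
Fixpoint alternates a s M : bool :=
  if M is (x, b) :: M' then
    if x == a then (b != s) && alternates a b M' else alternates a s M'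
  else s.

(* The states are the sets of letters whose last occurrence is in the upper
   row; None is failure. *)
Definition step (S : option {set A}) (x : A * bool) : option {set A} :=
  if S is Some S' then
    if (x.1 \in S') == x.2 then None
    else Some (if x.2 then x.1 |: S' else S' :\ x.1)
  else None.

Definition run S M : option {set A} := foldl step (Some S) M.

Lemma foldl_step_None M : foldl step None M = None.
Proof. by elim: M. Qed.

Lemma run_cat S M M' :
  run S (M ++ M') = if run S M is Some S' then run S' M' else None.
Proof.
rewrite /run foldl_cat; case: (foldl _ _ M) => //; exact: foldl_step_None.
Qed.

(** A step changes the membership of one letter only, so the run is one two-state automaton per
    letter; it fails exactly when some letter repeats its row. *)
Lemma run_alternates S M :
  (run S M == Some setT) = [forall a, alternates a (a \in S) M].
Proof.
elim: M S => [|[x b] M IH] S /=.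
  apply/eqP/forallP => [[->] a|h]; first by rewrite inE.
  by congr Some; apply/setP=> a; rewrite h inE.
rewrite /run /=; case: ((x \in S) =P b) => [xS|xS].
  rewrite foldl_step_None; apply/esym/negP => /forallP /(_ x).
  by rewrite /= eqxx xS eqxx.
rewrite -[foldl _ _ _]/(run _ M) IH; apply: eq_forallb => a.
have [->|nax] := eqVneq a x.
  have -> : b != (x \in S) by apply/eqP => bS; apply: xS.
  by case: b {xS}; rewrite !inE eqxx.
by case: b {xS}; rewrite !inE (negPf nax).
Qed.

End Alternation.

(** * Alternation inside a sorted list *)

Section Separation.
Variables (T : eqType) (lt : rel T) (b : pred T).
Hypotheses (lt_tr : transitive lt) (lt_irr : irreflexive lt).
Implicit Types (s : bool) (L : seq T).

(* s tells whether a virtual element satisfying b precedes L. *)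
Definition separated s L : Prop :=
  {in L &, forall p q, b p -> b q -> lt p q ->
     exists2 r, r \in L & [/\ ~~ b r, lt p r & lt r q]} /\
  (s -> {in L, forall q, b q -> exists2 r, r \in L & ~~ b r /\ lt r q}).

(** Peel off the least element [p]. If [b p], nothing separates it from a virtual predecessor, and
    [p] becomes the virtual element for [L]; otherwise [p] separates the virtual element from all of
    [L], which resets [s]. *)
Lemma separated_cons s p L : sorted lt (p :: L) ->
  separated s (p :: L) <->
  if b p then ~~ s /\ separated true L else separated false L.
Proof.
rewrite sorted_pairwise //= => /andP[/allP pL _].
have lt_asym x y : lt x y -> lt y x = false.
  by move=> xy; apply/negP => /(lt_tr xy); rewrite lt_irr.
have tail x r : x \in L -> r \in p :: L -> lt x r -> r \in L.
  move=> xL; rewrite inE => /predU1P[->|//] xp.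
  by rewrite (lt_asym _ _ (pL _ xL)) in xp.
case: ifP => bp; split.
- case=> sep first; split.
    apply/negP => /first /(_ p (mem_head _ _) bp) [r].
    rewrite inE => /predU1P[->|/pL pr] [_ rp]; first by rewrite lt_irr in rp.
    by rewrite (lt_asym _ _ pr) in rp.
  split=> [x y xL yL bx by' xy|_ q qL bq].
    have [||r rL [? xr ?]] := sep x y _ _ bx by' xy; rewrite ?inE ?xL ?yL ?orbT //.
    by exists r => //; apply: tail xr.
  have [||r rL [br pr rq]] := sep p q _ _ bp bq (pL _ qL);
    rewrite ?inE ?eqxx ?qL ?orbT //.
  exists r => //; move: rL; rewrite inE => /predU1P[rp|//].
  by rewrite rp lt_irr in pr.
- case=> /negPf -> [sep /(_ isT) first]; split=> // x y.
  rewrite !inE => /predU1P[->|xL] /predU1P[->|yL] bx by' xy.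
  + by rewrite lt_irr in xy.
  + have [r rL [? ?]] := first y yL by'.
    by exists r; rewrite ?inE ?rL ?orbT //; split=> //; apply: pL.
  + by rewrite (lt_asym _ _ (pL _ xL)) in xy.
  + by have [r rL ?] := sep x y xL yL bx by' xy; exists r; rewrite ?inE ?rL ?orbT.
- case=> sep _; split=> // x y xL yL bx by' xy.
  have [||r rL [? xr ?]] := sep x y _ _ bx by' xy; rewrite ?inE ?xL ?yL ?orbT //.
  by exists r => //; apply: tail xr.
- case=> sep _; split=> [x y|_ q]; rewrite !inE.
    case/predU1P=> [->|xL]; first by rewrite bp.
    case/predU1P=> [->|yL]; first by rewrite bp.
    move=> bx by' xy; have [r rL ?] := sep x y xL yL bx by' xy.
    by exists r; rewrite ?inE ?rL ?orbT.
  case/predU1P=> [->|qL]; first by rewrite bp.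
  by move=> _; exists p; rewrite ?mem_head // bp; split=> //; apply: pL.
Qed.

Lemma separated_count s L : sorted lt L -> separated s L ->
  count b L + s <= (count (predC b) L).+1.
Proof.
elim: L s => [|p L IH] s; first by case: s.
move=> sL; move/path_sorted: (sL) => sL'; move/(separated_cons s sL) => /=.
case: (b p) => /= [[/negPf -> /(IH _ sL')]|/(IH _ sL')]; case: s; lia.
Qed.

(** Separation puts at least one lower element between two upper ones, [s] counting as an upper one;
    the count makes it exactly one and leaves none at the ends. *)
Lemma alternates_separated (A : finType) (f : T -> A) a s L : sorted lt L ->
  let La := [seq p <- L | f p == a] in
  alternates a s [seq (f p, b p) | p <- L] <->
  count b La + s = (count (predC b) La).+1 /\ separated s La.
Proof.
move=> /(sorted_filter lt_tr (fun p => f p == a)) /=.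
have -> : alternates a s [seq (f p, b p) | p <- L] =
          alternates a s [seq (a, b p) | p <- [seq p <- L | f p == a]].
  by elim: L s => [|p L IH] s //=; case: eqP => //= _; rewrite eqxx IH.
elim: {L}[seq _ <- L | _] s => [|p L IH] s sL /=.
  by split=> [->|[/=]]; [split | case: s].
rewrite (separated_cons s sL) eqxx; have {}IH s' := IH s' (path_sorted sL).
case: (b p); case: s {sL} (sL) => sL /=; rewrite ?add0n.
- by split=> // -[_ []].
- by rewrite IH; split=> [[c sep]|[c [_ sep]]]; repeat split=> //; lia.
- by rewrite IH; split=> [[c sep]|[c sep]]; split=> //; lia.
(* A lower element with no upper one before it: the count needs two more upper than lower elements
   in [L], and separation allows only one more. *)
- by split=> // -[c /(separated_count (path_sorted sL))]; lia.
Qed.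

End Separation.

(** * Runs over interleaved rows *)

Fixpoint zigzag (T : Type) (w v : nat -> T) k : seq T :=
  if k is k'.+1 then zigzag w v k' ++ [:: v k'; w k] else [:: w 0].

Lemma map_zigzag (T U : Type) (f : T -> U) w v k :
  map f (zigzag w v k) = zigzag (f \o w) (f \o v) k.
Proof. by elim: k => //= k IH; rewrite map_cat IH. Qed.

Notation tagged_zigzag W V :=
  (zigzag (fun j => (W j, true)) (fun j => (V j, false))).

Section RunZigzag.
Variable A : finType.
Implicit Types (W V : nat -> A) (S : {set A}).

Lemma run_seq1 S a : run S [:: (a, true)] =
  if a \in S then None else Some (a |: S).
Proof. by rewrite /run /= eqb_id. Qed.

Lemma run_seq2 S a a' : run S [:: (a, false); (a', true)] =
  if (a \notin S) || (a' \in S :\ a) then None else Some (a' |: S :\ a).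
Proof.
by rewrite /run /= eqbF_neg; case: ifP => //= _; rewrite eqb_id.
Qed.

(** The state after an upper letter is a singleton, so a lower letter must repeat the upper letter
    just read, which empties the state again. *)
Lemma run_zigzag_set0 W V k S :
  run set0 (tagged_zigzag W V k) = Some S <->
  (forall j, j < k -> V j = W j) /\ S = [set W k].
Proof.
elim: k S => [|k IH] S.
  rewrite /= run_seq1 inE setU0.
  by split=> [[<-]|[_ ->]].
rewrite [tagged_zigzag _ _ _]/= run_cat; case E: (run _ _) => [S'|]; last first.
  split=> // -[VW _]; suff: run set0 (tagged_zigzag W V k) = Some [set W k] by rewrite E.
  by apply/IH; split=> // j jk; apply/VW/ltnW.
have /IH[VW ->] := E.
rewrite run_seq2 inE; have [VWk|nVW] := eqVneq (V k) (W k) => /=.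
  rewrite VWk setDv inE setU0; split=> [[<-]|[_ ->]] //; split=> // j.
  by rewrite ltnS leq_eqVlt => /predU1P[->|/VW].
by split=> // -[/(_ k (ltnSn k)) /eqP]; rewrite (negPf nVW).
Qed.

(** Only [z] can enter first, and it fills the state; each lower letter then leaves, and only that
    same letter can enter next. *)
Lemma run_zigzag_setC1 W V k z S :
  run (~: [set z]) (tagged_zigzag W V k) = Some S <->
  [/\ W 0 = z, forall j, j < k -> V j = W j.+1 & S = setT].
Proof.
elim: k S => [|k IH] S.
  rewrite /= run_seq1 !inE; case: eqVneq => [->|nW] /=.
    by rewrite setUCr; split=> [[<-]|[_ _ ->]].
  by split=> // -[/eqP]; rewrite (negPf nW).
rewrite [tagged_zigzag _ _ _]/= run_cat; case E: (run _ _) => [S'|]; last first.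
  split=> // -[W0 VW _].
  suff: run (~: [set z]) (tagged_zigzag W V k) = Some setT by rewrite E.
  by apply/IH; split=> // j jk; apply/VW/ltnW.
have /IH[W0 VW ->] := E.
rewrite run_seq2 !inE /= andbT; have [VWk|nVW] := eqVneq (W k.+1) (V k) => /=.
  rewrite VWk setTD setUCr; split=> [[<-]|[_ _ ->]] //; split=> // j.
  by rewrite ltnS leq_eqVlt => /predU1P[->|/VW].
by split=> // -[_ /(_ k (ltnSn k)) /esym/eqP]; rewrite (negPf nVW).
Qed.

End RunZigzag.

(* The letter distinct from a and b, for a != b. *)
Definition third (a b : 'I_3) : 'I_3 := Ordinal (ltn_pmod (3 - (a + b)) (isT : 0 < 3)).

(** [Left], [Right] and [Bottom] double as the letters 1, 2, 3 and as the three triangles; on these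
    closed constants finite checks are settled by computation. *)
Lemma ord3_ind (P : 'I_3 -> Prop) : P Left -> P Right -> P Bottom -> forall a, P a.
Proof.
move=> P0 P1 P2 [[|[|[|m]]] lt_m] //.
- by rewrite (_ : Ordinal lt_m = Left) //; apply: val_inj.
- by rewrite (_ : Ordinal lt_m = Right) //; apply: val_inj.
- by rewrite (_ : Ordinal lt_m = Bottom) //; apply: val_inj.
Qed.

Lemma uniq_third a b c : uniq [:: a; b; c] = (a != b) && (c == third a b).
Proof. by elim/ord3_ind: a; elim/ord3_ind: b; elim/ord3_ind: c. Qed.

Lemma set2_third a b : a != b -> [set a; b] = ~: [set third a b].
Proof.
move=> nab; apply/setP=> c; rewrite !inE.
by elim/ord3_ind: a nab; elim/ord3_ind: b; elim/ord3_ind: c.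
Qed.

Lemma setC1_third a b : a != b -> ~: [set a] :\ b = [set third a b].
Proof.
move=> nab; apply/setP=> c; rewrite !inE.
by elim/ord3_ind: a nab; elim/ord3_ind: b; elim/ord3_ind: c.
Qed.

(* In a strip along a line parallel to the right side, W and V list the labels
   of the right edges of the up and of the down faces; this is the label of the
   left edge of the j-th up face, that of the first one being x. *)
Fixpoint strip (W V : nat -> 'I_3) (x : 'I_3) (j : nat) : 'I_3 :=
  if j is j'.+1 then third (third (strip W V x j') (W j')) (V j') else x.

(** Adding [W j] to a singleton [[set x]] gives the complement of [third x (W j)]; removing [V j]
    leaves a singleton again, the next value of [strip]. The inequalities say that no step fails;
    they are the face conditions along the strip. *)
Lemma run_zigzag_set1 (W V : nat -> 'I_3) k x S :
  run [set x] (tagged_zigzag W V k) = Some S <->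
  [/\ forall j, j <= k -> strip W V x j != W j,
      forall j, j < k -> third (strip W V x j) (W j) != V j
    & S = ~: [set third (strip W V x k) (W k)]].
Proof.
elim: k S => [|k IH] S.
  rewrite /= run_seq1 !inE eq_sym; have [->|nxW] := eqVneq x (W 0).
    by split=> // -[/(_ 0 (leqnn 0))]; rewrite eqxx.
  rewrite setUC (set2_third nxW); split=> [[<-]|[_ _ ->] //]; split=> // j.
  by rewrite leqn0 => /eqP->.
rewrite [tagged_zigzag _ _ _]/= run_cat; case E: (run _ _) => [S'|]; last first.
  split=> // -[XW YV _].
  have: run [set x] (tagged_zigzag W V k) =
      Some (~: [set third (strip W V x k) (W k)]); last by rewrite E.
  apply/IH; split=> // j jk; [apply/XW/leqW | apply/YV/leqW] => //.
have /IH[XW YV ->] := E.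
rewrite run_seq2 !inE negbK eq_sym.
have [eqYV|nYV] := eqVneq _ (V k).
  by split=> // -[_ /(_ k (ltnSn k))]; rewrite eqYV eqxx.
rewrite (setC1_third nYV) /= -/(strip W V x k.+1).
(* A letter avoiding the two distinct letters [y] and [V k] is their [third], the element of the
   next singleton. *)
have -> : (W k.+1 != V k) && (W k.+1 != third (strip W V x k) (W k)) =
   (strip W V x k.+1 == W k.+1).
  rewrite /=; move: (V k) nYV (W k.+1) => v; set y := third _ _.
  by elim/ord3_ind: y; elim/ord3_ind: v => // _; elim/ord3_ind.
have [eqXW|nXW] := eqVneq (strip W V x k.+1) (W k.+1).
  by split=> // -[/(_ k.+1 (leqnn _))]; rewrite eqXW eqxx.
rewrite setUC (set2_third nXW); split=> [[<-]|[_ _ ->] //]; split=> // j.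
  by rewrite leq_eqVlt => /predU1P[->|/XW].
by rewrite ltnS leq_eqVlt => /predU1P[->|/YV].
Qed.

Lemma zigzag_path (T : Type) (lt : rel T) w v k :
    (forall j, j < k -> lt (w j) (v j) && lt (v j) (w j.+1)) ->
  exists t, [/\ zigzag w v k = w 0 :: t, last (w 0) t = w k & path lt (w 0) t].
Proof.
elim: k => [|k IH] lt_wv; first by exists [::].
have [j jk|t [zt lt_t pt]] := IH; first exact/lt_wv/ltnW.
exists (t ++ [:: v k; w k.+1]); rewrite /= zt; split=> //.
  by rewrite last_cat.
by rewrite cat_path pt lt_t /= andbT lt_wv.
Qed.

Lemma mem_zigzag (T : eqType) (x : T) w v k : x \in zigzag w v k =
  (x \in [seq w j | j <- iota 0 k.+1]) || (x \in [seq v j | j <- iota 0 k]).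
Proof.
elim: k => [|k IH]; first by rewrite /= orbF.
have iotaSr m : iota 0 m.+1 = iota 0 m ++ [:: m] by rewrite -addn1 iotaD.
rewrite [zigzag _ _ _]/= mem_cat IH (iotaSr k.+1) (iotaSr k) !map_cat !mem_cat !inE.
by do ![case: (_ == _) | case: (_ \in _)].
Qed.

(** * Consecutive rows of an array *)

Section Positions.
Variable n : nat.
Implicit Types (i : 'I_3) (T : array 3 n.+1).
Local Notation position := (pos 3 n.+1).

(** Natural-number indices keep bound proofs out of terms; outside [j <= k <= n] the position is
    arbitrary. *)
Definition mkpos i (j k : nat) : position :=
  (i, insubd (exist (fun jk : 'I_n.+1 * 'I_n.+1 => jk.1 <= jk.2) (ord0, ord0) isT)
        (inord j, inord k)).

Lemma mkposE i j k : j <= k <= n ->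
  [/\ tri (mkpos i j k) = i, col_of (mkpos i j k) = j :> nat
    & row_of (mkpos i j k) = k :> nat].
Proof.
case/andP=> jk kn.
have jn := leq_trans jk kn.
rewrite /col_of /row_of /mkpos /= val_insubd /= !inordK // jk.
by rewrite !inordK.
Qed.

Lemma tri_mkpos i j k : tri (mkpos i j k) = i. Proof. by []. Qed.
Lemma col_mkpos i j k : j <= k <= n -> col_of (mkpos i j k) = j :> nat.
Proof. by case/(mkposE i). Qed.
Lemma row_mkpos i j k : j <= k <= n -> row_of (mkpos i j k) = k :> nat.
Proof. by case/(mkposE i). Qed.

Lemma pos_bounds (p : position) : col_of p <= row_of p <= n.
Proof. by rewrite (valP p.2) -ltnS ltn_ord. Qed.

Lemma pos_eqP (p q : position) : tri p = tri q ->
  col_of p = col_of q :> nat -> row_of p = row_of q :> nat -> p = q.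
Proof.
case: p q => [i [[j k] jk]] [i' [[j' k'] jk']]; rewrite /tri /col_of /row_of /=.
move=> -> /val_inj ej /val_inj ek; congr pair; apply: val_inj.
by rewrite /= ej ek.
Qed.

Lemma mkpos_id (p : position) : mkpos (tri p) (col_of p) (row_of p) = p.
Proof.
have b := pos_bounds p.
by apply: pos_eqP; rewrite ?tri_mkpos ?col_mkpos ?row_mkpos.
Qed.

Lemma h_mkpos i j k : j <= k <= n -> h (mkpos i j k) =
  (i.+1%:R * n.+1%:R + j.+1%:R - (n.+1%:R + k.+1%:R) / 2%:R)%R.
Proof. by move=> b; rewrite /h tri_mkpos col_mkpos ?row_mkpos. Qed.

Lemma h_mkpos_down i j k : j <= k < n ->
  (h (mkpos i j k.+1) < h (mkpos i j k))%R.
Proof.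
by case/andP=> jk kn; rewrite !h_mkpos; first (rewrite -(natr1 k.+1); lra); lia.
Qed.

Lemma h_mkpos_up i j k : j <= k < n ->
  (h (mkpos i j k) < h (mkpos i j.+1 k.+1))%R.
Proof.
case/andP=> jk kn; rewrite !h_mkpos; last 2 first; try lia.
by rewrite -(natr1 k.+1) -(natr1 j.+1); lra.
Qed.

(** The next triangle gains n + 1, the return to the first entry of the row loses k, and k <= n. *)
Lemma h_mkpos_next i i' k : k <= n -> i' = i.+1 :> nat ->
  (h (mkpos i k k) < h (mkpos i' 0 k))%R.
Proof.
move=> kn ei; rewrite !h_mkpos; last 2 first; try lia.
rewrite ei -(natr1 i.+1) [((_ + 1) * _)%R]mulrDl mul1r.
have : (k.+1%:R <= n.+1%:R :> rat)%R by rewrite ler_nat.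
have : (0 <= n.+1%:R :> rat)%R by rewrite ler0n.
by lra.
Qed.

(* For k = 0 the lower row is absent, and k.-1 does not occur in the zigzag. *)
Definition two_rows k : seq position :=
  let block i := zigzag (fun j => mkpos i j k) (fun j => mkpos i j k.-1) k in
  block Left ++ block Right ++ block Bottom.

Definition h_lt : rel position := relpre (@h 3 n.+1) <%R.

Lemma h_lt_trans : transitive h_lt.
Proof. move=> p q r; exact: lt_trans. Qed.

Lemma h_lt_irr : irreflexive h_lt.
Proof. move=> p; exact: ltxx. Qed.

Lemma two_rows_sorted k : k <= n -> sorted h_lt (two_rows k).
Proof.
move=> kn; rewrite /two_rows.
have block_path i : exists t,
    [/\ zigzag (fun j => mkpos i j k) (fun j => mkpos i j k.-1) k
          = mkpos i 0 k :: t,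
        last (mkpos i 0 k) t = mkpos i k k
      & path h_lt (mkpos i 0 k) t].
  apply: zigzag_path => j jk; case: k kn jk => // k kn jk.
  by rewrite /h_lt /= h_mkpos_down ?h_mkpos_up // -ltnS jk.
have [t0 [-> l0 p0]] := block_path Left.
have [t1 [-> l1 p1]] := block_path Right.
have [t2 [-> _ p2]] := block_path Bottom.
rewrite /= cat_path p0 l0 /= cat_path p1 l1 /= p2.
by rewrite /h_lt /= !h_mkpos_next.
Qed.

Lemma mem_two_rows k p : k <= n ->
  (p \in two_rows k) = (row_of p == k :> nat) || ((row_of p).+1 == k).
Proof.
move=> kn.
have block i : (p \in zigzag (fun j => mkpos i j k) (fun j => mkpos i j k.-1) k) =
    (tri p == i) && ((row_of p == k :> nat) || ((row_of p).+1 == k)).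
  rewrite mem_zigzag; apply/orP/andP.
    case=> /mapP[j]; rewrite mem_iota add0n /= => jk ->.
      by rewrite row_mkpos ?eqxx //; lia.
    rewrite tri_mkpos row_mkpos ?eqxx; last lia.
    by split=> //; apply/orP; right; apply/eqP; lia.
  have := pos_bounds p => pb [/eqP pi /orP[/eqP pk|/eqP pk]]; [left|right].
    apply/mapP; exists (val (col_of p)); first by rewrite mem_iota /=; lia.
    by rewrite -pi -pk mkpos_id.
  apply/mapP; exists (val (col_of p)); first by rewrite mem_iota /=; lia.
  by rewrite -pi -pk mkpos_id.
rewrite !mem_cat !block -!andb_orl.
by move: (tri p); elim/ord3_ind.
Qed.

Lemma two_rows_uniq k : k <= n -> uniq (two_rows k).
Proof. by move=> /two_rows_sorted; apply: sorted_uniq h_lt_trans h_lt_irr _. Qed.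

Definition row_run T k :=
  run set0 [seq (T p, row_of p == k :> nat) | p <- two_rows k].

Lemma count_two_rows (P : pred position) k : k <= n ->
    {subset P <= two_rows k} -> count P (two_rows k) = #|P|.
Proof.
move=> kn sP; rewrite -size_filter -(card_uniqP _) ?filter_uniq ?two_rows_uniq //.
apply: eq_card => p; rewrite mem_filter.
by rewrite -[P p]/(p \in P); apply/andP/idP => [[]|pP] //; split=> //; apply: sP.
Qed.

(** [run_alternates] splits the condition by letters, and [alternates_separated] turns each part
    into counting and interlacing. A run sees only two rows, so the count is relative to the lower
    row. *)
Lemma row_runP T k : k <= n ->
  row_run T k = Some setT <->
  (forall a, #|[set p | row_of p == k :> nat & T p == a]| =
             #|[set p | (row_of p).+1 == k & T p == a]|.+1) /\
  (forall p q, row_of p = k :> nat -> row_of q = k :> nat -> T p = T q ->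
    (h p < h q)%R ->
    exists r, [/\ (row_of r).+1 = k, T r = T p & (h p < h r < h q)%R]).
Proof.
move=> kn; have srt := two_rows_sorted kn.
pose b (p : position) := row_of p == k :> nat.
have alt a := alternates_separated b h_lt_trans h_lt_irr T a false srt.
have notb p : p \in two_rows k -> ~~ b p = ((row_of p).+1 == k).
  by rewrite mem_two_rows // /b; case: eqP => [->|] //=; rewrite gtn_eqF.
have cntT a : count b [seq p <- two_rows k | T p == a] =
    #|[set p | row_of p == k :> nat & T p == a]|.
  rewrite count_filter count_two_rows //; first by rewrite cardsE; apply: eq_card.
  by move=> p /andP[pk _]; rewrite mem_two_rows // -/(b p) pk.
have cntF a : count (predC b) [seq p <- two_rows k | T p == a] =
    #|[set p | (row_of p).+1 == k & T p == a]|.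
  rewrite count_filter -(count_two_rows kn); last first.
    by move=> p; rewrite in_set mem_two_rows // => /andP[-> _]; rewrite orbT.
  apply: eq_in_count => p pL /=; rewrite notb //.
  by rewrite -[RHS]/(p \in finset _) in_set andbC.
split.
  move/eqP; rewrite run_alternates => /forallP altT.
  split=> [a|p q pk qk Tpq pq].
    by have := altT a; rewrite inE => /alt[]; rewrite addn0 cntT cntF.
  have := altT (T p); rewrite inE => /alt[_ [sep _]].
  have inL r : row_of r = k :> nat -> T r = T p ->
    r \in [seq p' <- two_rows k | T p' == T p].
    by move=> rk Tr; rewrite mem_filter Tr eqxx mem_two_rows // rk eqxx.
  have [r] := sep p q (inL p pk erefl) (inL q qk (esym Tpq)) (introT eqP pk)
    (introT eqP qk) pq.
  rewrite mem_filter => /andP[/eqP Tr rL] [br pr rq].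
  by exists r; rewrite Tr; split=> //; [apply/eqP; rewrite -notb | apply/andP].
case=> cnt inter; apply/eqP; rewrite run_alternates; apply/forallP => a.
rewrite inE; apply/alt; split; first by rewrite addn0 cntT cntF.
split=> // p q; rewrite !mem_filter => /andP[/eqP Tp pL] /andP[/eqP Tq qL].
move=> /eqP pk /eqP qk pq.
have [|r [rk Tr /andP[pr rq]]] := inter p q pk qk _ pq; first by rewrite Tp.
have rL : r \in two_rows k by rewrite mem_two_rows // rk eqxx orbT.
by exists r; [rewrite mem_filter Tr Tp eqxx | split=> //; rewrite notb // rk].
Qed.

(** The absolute counts of [balanced] telescope from the relative ones, starting below row 0, where
    all counts are 0. *)
Lemma interlacing_row_run T : balanced T && interlacing T <->
  forall k, k <= n -> row_run T k = Some setT.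
Proof.
split=> [/andP[bal inter] k kn|runT].
  apply/row_runP=> //; split=> [a|p q pk qk Tpq pq].
    have cnt (k' : nat) : k' <= n ->
        #|[set p | row_of p == k' :> nat & T p == a]| = k'.+1.
      move=> k'n; rewrite -{2}(inordK (k'n : k' < n.+1)).
      rewrite -(eqP (forallP (forallP bal (inord k')) a)).
      by apply: eq_card => p; rewrite !inE -(inj_eq val_inj (row_of p)) /= inordK.
    rewrite cnt //; case: k kn => [|k] kn.
      by rewrite eq_card0 // => p; rewrite inE.
    by congr S; rewrite -[LHS](cnt k (ltnW kn)); apply: eq_card => p; rewrite !inE.
  have := forallP (forallP inter p) q; rewrite Tpq eqxx pq.
  rewrite -val_eqE /= pk qk eqxx => /existsP[r /and3P[/eqP rk /eqP Tr hr]].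
  by exists r.
have {}runT k : k <= n -> _ := fun kn => (row_runP T kn).1 (runT k kn).
apply/andP; split.
  apply/forallP=> -[k kn]; apply/forallP=> a; apply/eqP => /=.
  transitivity #|[set p | row_of p == k :> nat & T p == a]|.
    by apply: eq_card => p; rewrite !inE -val_eqE.
  elim: k {kn}(kn : k <= n) => [|k IH] kn; rewrite (runT _ kn).1.
    by rewrite eq_card0 // => p; rewrite inE.
  by congr S; rewrite -[RHS](IH (ltnW kn)); apply: eq_card => p; rewrite !inE.
apply/forallP=> p; apply/forallP=> q; apply/implyP=> /and3P[/eqP rpq /eqP Tpq pq].
have /andP[_ pn] := pos_bounds p.
have [r [rp Tr hr]] := (runT _ pn).2 p q erefl (congr1 val (esym rpq)) Tpq pq.
by apply/existsP; exists r; rewrite rp Tr !eqxx.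
Qed.

End Positions.

Lemma eq_in_zigzag (T : Type) (w w' v v' : nat -> T) k :
    (forall j, j <= k -> w j = w' j) -> (forall j, j < k -> v j = v' j) ->
  zigzag w v k = zigzag w' v' k.
Proof.
elim: k => [|k IH] eq_w eq_v /=; first by rewrite eq_w.
rewrite (eq_w k.+1) // (eq_v k) // IH // => j jk; first exact/eq_w/leqW.
exact/eq_v/leqW.
Qed.

Lemma eq_in_strip (W W' V V' : nat -> 'I_3) x k :
    (forall j, j < k -> W j = W' j) -> (forall j, j < k -> V j = V' j) ->
  strip W V x k = strip W' V' x k.
Proof.
elim: k => //= k IH eq_W eq_V; rewrite eq_W // eq_V // IH // => j jk.
  exact/eq_W/leqW.
exact/eq_V/leqW.
Qed.

(** The three blocks lead from [set0] through a singleton and the complement of a singleton to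
    [setT]; the last condition matches the missing letter with the first letter of the third
    triangle. *)
Lemma row_run_strip n (T : array 3 n.+1) k : k <= n ->
  let t i j k' := T (mkpos n i j k') in
  let X := strip (t Right ^~ k) (t Right ^~ k.-1) (t Left k k) in
  row_run T k = Some setT <->
  [/\ forall j, j < k -> t Left j k.-1 = t Left j k,
      forall j, j < k -> t Bottom j k.-1 = t Bottom j.+1 k,
      forall j, j <= k -> X j != t Right j k,
      forall j, j < k -> third (X j) (t Right j k) != t Right j k.-1
    & t Bottom 0 k = third (X k) (t Right k k)].
Proof.
move=> kn /=; rewrite /row_run /two_rows !map_cat !map_zigzag.
have tagged i : zigzag ((fun p => (T p, row_of p == k :> nat)) \o fun j => mkpos n i j k)
    ((fun p => (T p, row_of p == k :> nat)) \o fun j => mkpos n i j k.-1) k =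
  tagged_zigzag (fun j => T (mkpos n i j k)) (fun j => T (mkpos n i j k.-1)) k.
  apply: eq_in_zigzag => j jk /=; rewrite row_mkpos ?eqxx //; try lia.
  by congr pair; apply/eqP; lia.
rewrite !tagged run_cat.
case E0: (run set0 _) => [S0|]; last first.
  split=> // -[VW0 _ _ _ _].
  have /run_zigzag_set0 : _ /\ [set T (mkpos n Left k k)] = _ := conj VW0 erefl.
  by rewrite E0.
have /run_zigzag_set0[VW0 ->] := E0.
rewrite run_cat.
case E1: (run [set _] _) => [S1|]; last first.
  split=> // -[_ _ XW YV _].
  by have := iffRL (run_zigzag_set1 _ _ _ _ _) (And3 XW YV erefl); rewrite E1.
have /run_zigzag_set1[XW YV ->] := E1.
rewrite run_zigzag_setC1; split=> [[W0 VW _]|[? ? ? ? ?]]; first by split.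
by split.
Qed.

Lemma uniq_third_l a b : a != b -> uniq [:: third a b; b; a].
Proof. by elim/ord3_ind: a; elim/ord3_ind: b. Qed.

(** * Puzzles in coordinates *)

(** As with [mkpos], the cell is arbitrary outside [x + y <= m]. *)
Definition mkc m x y : cell m.+1 :=
  insubd (@mkcell m.+1 0 0 (ltn0Sn m)) (inord x, inord y).

Lemma mkcE m x y (xy : x + y < m.+1) : mkcell xy = mkc m x y.
Proof.
have xm : x < m.+1 := leq_ltn_trans (leq_addr y x) xy.
have ym : y < m.+1 := leq_ltn_trans (leq_addl x y) xy.
apply: val_inj; rewrite /mkc val_insubd /= !inordK // xy.
by congr pair; apply: val_inj; rewrite /= inordK.
Qed.

Lemma mkc_id m (f : cell m.+1) : mkc m (xc f) (yc f) = f.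
Proof.
rewrite -(mkcE (cellP f)); apply: val_inj; case: f => -[[x ?] [y ?]] ? /=.
by congr pair; apply: val_inj.
Qed.

Lemma xc_mkc m x y : x + y <= m -> xc (mkc m x y) = x.
Proof. by move=> xy; rewrite -(mkcE (xy : x + y < m.+1)). Qed.

Lemma yc_mkc m x y : x + y <= m -> yc (mkc m x y) = y.
Proof. by move=> xy; rewrite -(mkcE (xy : x + y < m.+1)). Qed.

Section EdgeLabels.
Variables (n : nat) (L : finType).
Implicit Types (P : {ffun edge n.+1 -> L}) (lam : 'I_3 -> n.+1.-tuple L).

Definition label P d x y : L := P (d, mkc n x y).
Definition letter lam s i : L := tnth (lam s) (inord i).

Lemma labelE P d x y (xy : x + y < n.+1) : P (d, mkcell xy) = label P d x y.
Proof. by rewrite mkcE. Qed.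

Lemma has_boundaryP P lam : has_boundary lam P <->
  forall i, i <= n ->
    [/\ label P Left 0 i = letter lam Left i,
        label P Right i (n - i) = letter lam Right i
      & label P Bottom (n - i) 0 = letter lam Bottom i].
Proof.
split=> [/forallP bP i i_n|bP].
  have b s := eqP (forallP (bP s) (inord i)).
  by rewrite /letter -!b /bedge /= !labelE /= !inordK.
apply/forallP=> s; apply/forallP=> i; apply/eqP.
have := bP i (ltn_ord i); rewrite /letter inord_val => -[b0 b1 b2].
elim/ord3_ind: s; rewrite /bedge /= labelE //= ?subSS //.
Qed.

Definition faces_ok (ok : L -> L -> L -> bool) P : Prop :=
  (forall x y, x + y <= n ->
     ok (label P Left x y) (label P Right x y) (label P Bottom x y)) /\
  (forall x y, x + y < n ->
     ok (label P Left x.+1 y) (label P Right x y) (label P Bottom x y.+1)).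

Lemma faces_okP (ok : L -> L -> L -> bool) P :
  [forall f : up_face n.+1, ok (P (Left, f)) (P (Right, f)) (P (Bottom, f))] &&
  [forall g : down_face n.+1,
     ok (P (Left, mkcell (downx_subproof g))) (P (Right, mkcell (down0_subproof g)))
        (P (Bottom, mkcell (downy_subproof g)))] <->
  faces_ok ok P.
Proof.
split=> [/andP[/forallP up /forallP down]|[up down]].
  split=> x y xy; first exact: up.
  by have := down (mkcell (xy : x + y < n.+1.-1)); rewrite !labelE.
apply/andP; split; apply/forallP=> f; last first.
  by rewrite !labelE; apply: down; exact: (cellP f).
by rewrite -(mkc_id f); apply: up; exact: (cellP f).
Qed.

End EdgeLabels.

Lemma puzzles123P n lam (P : {ffun edge n.+1 -> 'I_3}) :
  P \in puzzles123 lam <->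
  faces_ok (fun a b c => uniq [:: a; b; c]) P /\ has_boundary lam P.
Proof.
rewrite inE; split.
  by case/and3P=> up down bP; split=> //; apply/faces_okP/andP.
by case=> /faces_okP/andP[? ?] ?; apply/and3P.
Qed.

(** * Relabeling 1/2/3-puzzles as 0/1/10-puzzles *)

Definition letter_of_symbol (s : 'I_3) (x : symbol) : 'I_3 :=
  nth Left [seq a <- [:: Left; Right; Bottom] | str_letter s a == x] 0.

Lemma str_letterK s : cancel (str_letter s) (letter_of_symbol s).
Proof. by move=> a; elim/ord3_ind: s; elim/ord3_ind: a. Qed.

Lemma letter_of_symbolK s : cancel (letter_of_symbol s) (str_letter s).
Proof. by move=> x; elim/ord3_ind: s; case: x. Qed.

(** The six orders of three distinct letters become the six allowed triples. [down_edges] lists a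
    face in rotated order, so one table serves both orientations. *)
Lemma allowed_str a b c :
  ((str_letter Left a, str_letter Right b, str_letter Bottom c)
     \in allowed_faces) = uniq [:: a; b; c].
Proof. by elim/ord3_ind: a; elim/ord3_ind: b; elim/ord3_ind: c. Qed.

Lemma puzzles123_0110 n (lam : 'I_3 -> n.+1.-tuple 'I_3) :
  in_bijection (puzzles123 lam) (puzzles0110 (str_map lam)).
Proof.
pose F (P : {ffun edge n.+1 -> 'I_3}) : {ffun edge n.+1 -> symbol} :=
  [ffun e => str_letter e.1 (P e)].
pose G (Q : {ffun edge n.+1 -> symbol}) : {ffun edge n.+1 -> 'I_3} :=
  [ffun e => letter_of_symbol e.1 (Q e)].
have FK : cancel F G by move=> P; apply/ffunP=> e; rewrite !ffunE str_letterK.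
have GK : cancel G F by move=> P; apply/ffunP=> e; rewrite !ffunE letter_of_symbolK.
have F_in P : (F P \in puzzles0110 (str_map lam)) = (P \in puzzles123 lam).
  rewrite !inE; congr [&& _, _ & _].
  - by apply: eq_forallb => f; rewrite /allowed_labels /up_edges !ffunE allowed_str.
  - by apply: eq_forallb => f; rewrite /allowed_labels /down_edges !ffunE allowed_str.
  - apply: eq_forallb => s; apply: eq_forallb => i.
    by rewrite ffunE tnth_map (can_eq (@str_letterK s)).
apply: (in_bijectionP (f := F)) => [P|P P' _ _|Q QP].
- by rewrite F_in.
- exact: can_inj.
- by exists (G Q); rewrite ?GK // -F_in GK.
Qed.

(** * Arrays and 1/2/3-puzzles *)

Section ArraysAndPuzzles.
Variables (n : nat) (lam : 'I_3 -> n.+1.-tuple 'I_3).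
Implicit Types (T : array 3 n.+1) (P : {ffun edge n.+1 -> 'I_3}).
Local Notation mkp := (mkpos n).

(** The top row determines the first and third triangles, which leaves the second one, subject to
    the strip conditions in each row. *)
Lemma interlacing_arraysP T : T \in interlacing_arrays lam <->
  [/\ forall j k, j <= k <= n -> T (mkp Left j k) = letter lam Left j,
      forall j k, j <= k <= n -> T (mkp Bottom j k) = letter lam Bottom (n - k + j),
      forall j, j <= n -> T (mkp Right j n) = letter lam Right j
    & forall k, k <= n ->
      let X := strip (fun j => T (mkp Right j k)) (fun j => T (mkp Right j k.-1))
                 (letter lam Left k) in
      [/\ forall j, j <= k -> X j != T (mkp Right j k),
          forall j, j < k -> third (X j) (T (mkp Right j k)) != T (mkp Right j k.-1)
        & letter lam Bottom (n - k) = third (X k) (T (mkp Right k k))]].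
Proof.
have top : top_row lam T <-> forall s j, j <= n -> T (mkp s j n) = letter lam s j.
  split=> [/forallP topT s j jn|topT].
    have := topT (mkp s j n).
    rewrite row_mkpos ?jn ?leqnn // eqxx => /eqP ->; congr tnth.
    by apply: val_inj; rewrite /= col_mkpos ?jn ?leqnn // inordK.
  apply/forallP=> p; apply/implyP=> /eqP[pn]; have := pos_bounds p.
  rewrite pn => /andP[/topT tp _].
  by rewrite -{1}(mkpos_id p) pn tp /letter inord_val.
rewrite inE andbA; split.
  case/andP=> /interlacing_row_run runT /top topT.
  have stripT k (kn : k <= n) := (row_run_strip T kn).1 (runT k kn).
  (* Descend from the top row: each row of the first triangle drops its last entry, and below each
     row of the third drops its first, which shifts the index. *)
  have Tleft m j : m + j <= n -> T (mkp Left j (n - m)) = letter lam Left j.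
    elim: m => [|m IH] mj; first by rewrite subn0 topT.
    rewrite -IH ?(ltnW mj) //; have [|TL _ _ _ _] := stripT (n - m); first lia.
    rewrite -TL; last lia.
    by congr (T (mkp _ _ _)); lia.
  have Tbottom m j : m + j <= n -> T (mkp Bottom j (n - m)) = letter lam Bottom (m + j).
    elim: m j => [|m IH] j mj; first by rewrite subn0 topT.
    rewrite addSnnS -IH ?addnS //; have [|_ TB _ _ _] := stripT (n - m); first lia.
    rewrite -TB; last lia.
    by congr (T (mkp _ _ _)); lia.
  have TL j k : j <= k <= n -> T (mkp Left j k) = letter lam Left j.
    move=> jk; rewrite -(Tleft (n - k)); last lia.
    by congr (T (mkp _ _ _)); lia.
  have TB j k : j <= k <= n -> T (mkp Bottom j k) = letter lam Bottom (n - k + j).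
    move=> jk; rewrite -Tbottom; last lia.
    by congr (T (mkp _ _ _)); lia.
  split=> // [j jn|k kn]; first exact: topT.
  have [_ _ XW YV] := stripT k kn; rewrite TL ?leqnn // in XW YV *.
  by rewrite TB // addn0 => ->; split.
case=> TL TB TR TX; apply/andP; split.
  apply/interlacing_row_run => k kn; apply/row_run_strip => //.
  have [XW YV Yk] := TX k kn.
  rewrite TL ?leqnn // TB // addn0; split=> // j jk; rewrite ?TL ?TB //; try lia.
  by congr letter; lia.
apply/top => s j jn.
by elim/ord3_ind: s; [apply: TL | apply: TR | rewrite TB ?subnn]; rewrite ?jn ?leqnn.
Qed.

Definition array_of_puzzle P : array 3 n.+1 := [ffun p : pos 3 n.+1 =>
  if tri p == Left then letter lam Left (col_of p)
  else if tri p == Right then label P Right (col_of p) (row_of p - col_of p)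
  else letter lam Bottom (n - row_of p + col_of p)].

(** The left and bottom labels are the letters x and y for which the run passes through {x} and the
    complement of {y}. *)
Definition puzzle_of_array T : {ffun edge n.+1 -> 'I_3} := [ffun e : edge n.+1 =>
  let: (d, f) := e in
  let j := xc f in let k := xc f + yc f in
  let X := strip (fun j => T (mkp Right j k)) (fun j => T (mkp Right j k.-1))
             (letter lam Left k) j in
  if d == Left then X else if d == Right then T (mkp Right j k)
  else third X (T (mkp Right j k))].

(** From the left side on, each up face and then each down face has two known labels, which force
    the third; this is the recursion of [strip]. *)
Lemma puzzle_strip P k j : P \in puzzles123 lam -> j <= k <= n ->
  strip (fun j => label P Right j (k - j)) (fun j => label P Right j (k.-1 - j))
    (letter lam Left k) j = label P Left j (k - j).
Proof.
move=> /puzzles123P[[up down] /has_boundaryP bP].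
elim: j => [|j IH] /andP[jk kn] /=.
  by have [<- _ _] := bP k kn; rewrite subn0.
rewrite IH; last lia.
have up_jk : j + (k - j) <= n by lia.
have := up _ _ up_jk; rewrite uniq_third => /andP[_ /eqP <-].
have down_jk : j + (k - j.+1) < n by lia.
have := down _ _ down_jk.
have -> : (k - j.+1).+1 = k - j by lia.
have -> : k.-1 - j = k - j.+1 by lia.
move: (label P Left _ _) (label P Right _ _) (label P Bottom _ _) => a b c.
by elim/ord3_ind: a; elim/ord3_ind: b; elim/ord3_ind: c => // _; apply: val_inj.
Qed.

Lemma array_of_puzzle_in P :
  P \in puzzles123 lam -> array_of_puzzle P \in interlacing_arrays lam.
Proof.
move=> PP; have /puzzles123P[[up down] /has_boundaryP bP] := PP.
have FR j k : j <= k <= n ->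
    array_of_puzzle P (mkp Right j k) = label P Right j (k - j).
  by move=> jk; rewrite ffunE /= col_mkpos // row_mkpos.
apply/interlacing_arraysP; split=> [j k jk|j k jk|j jn|k kn X].
- by rewrite ffunE /= col_mkpos.
- by rewrite ffunE /= col_mkpos // row_mkpos.
- by rewrite FR ?jn ?leqnn //; have [] := bP j jn.
have XE j : j <= k -> X j = label P Left j (k - j).
  move=> jk; rewrite -puzzle_strip ?jk //; apply: eq_in_strip => i ij.
    by rewrite FR //; lia.
  by rewrite FR //; lia.
have up' j : j <= k -> X j != array_of_puzzle P (mkp Right j k) /\
    label P Bottom j (k - j) = third (X j) (array_of_puzzle P (mkp Right j k)).
  move=> jk; rewrite FR ?jk // XE //.
  have up_jk : j + (k - j) <= n by lia.
  by have := up _ _ up_jk; rewrite uniq_third => /andP[-> /eqP].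
split=> [j /up'[]|j jk|] //.
  have [_ <-] := up' j (ltnW jk); rewrite FR; last lia.
  have down_jk : j + (k - j.+1) < n by lia.
  have := down _ _ down_jk.
  have -> : (k - j.+1).+1 = k - j by lia.
  have -> : k.-1 - j = k - j.+1 by lia.
  by rewrite /= !inE negb_or => /and3P[_ /eqP ne _]; apply/eqP => /esym.
(* The last up face of the strip rests on the bottom side, read from right to left, whence the index
   n - k. *)
have [_ <-] := up' k (leqnn k); rewrite subnn.
by have [|_ _ <-] := bP (n - k); rewrite ?leq_subr // subKn.
Qed.

(** The array shows the right labels; [puzzle_strip] recovers the left ones, and the up faces give
    the bottom ones. *)
Lemma array_of_puzzle_inj : {in puzzles123 lam &, injective array_of_puzzle}.
Proof.
move=> P P' PP PP' eqA.
have eqR j k : j <= k <= n -> label P Right j (k - j) = label P' Right j (k - j).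
  move=> jk; have /ffunP/(_ (mkp Right j k)) := eqA.
  by rewrite !ffunE /= col_mkpos // row_mkpos.
have eqL j k : j <= k <= n -> label P Left j (k - j) = label P' Left j (k - j).
  move=> jk; rewrite -!puzzle_strip //; apply: eq_in_strip => i ij; apply: eqR; lia.
have eqB j k : j <= k <= n -> label P Bottom j (k - j) = label P' Bottom j (k - j).
  move=> jk; have [[up _] _] := iffLR (puzzles123P _ _) PP.
  have [[up' _] _] := iffLR (puzzles123P _ _) PP'.
  have jkn : j + (k - j) <= n by lia.
  have := up _ _ jkn; have := up' _ _ jkn.
  by rewrite !uniq_third eqL // eqR // => /andP[_ /eqP ->] /andP[_ /eqP ->].
apply/ffunP=> -[d f]; rewrite -(mkc_id f).
have fn : xc f <= xc f + yc f <= n by rewrite leq_addr -ltnS cellP.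
by elim/ord3_ind: d; rewrite -/(label P _ _ _) -/(label P' _ _ _)
  -(addKn (xc f) (yc f)) ?eqL ?eqR ?eqB.
Qed.

Lemma array_of_puzzle_surj T : T \in interlacing_arrays lam ->
  exists2 P, P \in puzzles123 lam & array_of_puzzle P = T.
Proof.
case/interlacing_arraysP=> TL TB TR TX.
have GR x y : x + y <= n ->
    label (puzzle_of_array T) Right x y = T (mkp Right x (x + y)).
  by move=> xy; rewrite /label ffunE /= xc_mkc // yc_mkc.
pose X k := strip (fun j => T (mkp Right j k)) (fun j => T (mkp Right j k.-1))
             (letter lam Left k).
have GL x y : x + y <= n -> label (puzzle_of_array T) Left x y = X (x + y) x.
  by move=> xy; rewrite /label ffunE /= xc_mkc // yc_mkc.
have GB x y : x + y <= n -> label (puzzle_of_array T) Bottom x y =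
    third (X (x + y) x) (T (mkp Right x (x + y))).
  by move=> xy; rewrite /label ffunE /= xc_mkc // yc_mkc.
exists (puzzle_of_array T).
  apply/puzzles123P; split; first split=> x y xy.
  - rewrite GL // GR // GB // uniq_third eqxx andbT.
    by have [XW _ _] := TX (x + y) xy; rewrite XW ?leq_addr.
  - rewrite GL // GR 1?ltnW // GB addnS //.
    have [_ YV _] := TX (x + y).+1 xy.
    have x_lt : x < (x + y).+1 by rewrite ltnS leq_addr.
    have := YV _ x_lt.
    by rewrite addSn; exact: uniq_third_l.
  apply/has_boundaryP=> i i_n; split.
  - by rewrite GL.
  - by rewrite GR subnKC // TR.
  - rewrite GB addn0 ?leq_subr //; have [|_ _ <-] := TX (n - i); first exact: leq_subr.
    by rewrite subKn.
apply/ffunP=> p; rewrite -{2}(mkpos_id p) ffunE; have := pos_bounds p.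
move: (tri p) (col_of p : nat) (row_of p : nat) => i j k jk.
elim/ord3_ind: i => /=; [by rewrite TL | | by rewrite TB].
by rewrite GR subnKC //; case/andP: jk.
Qed.

Lemma arrays_puzzles123 :
  in_bijection (interlacing_arrays lam) (puzzles123 lam).
Proof.
apply/in_bijection_sym/(in_bijectionP array_of_puzzle_in array_of_puzzle_inj).
exact: array_of_puzzle_surj.
Qed.

End ArraysAndPuzzles.

(** * Colorings and 1/2/3-puzzles *)

Lemma ord4_ind (P : 'I_4 -> Prop) : P ord0 -> P (lift ord0 Left) ->
  P (lift ord0 Right) -> P (lift ord0 Bottom) -> forall c, P c.
Proof.
move=> P0 P1 P2 P3 c; case: (unliftP ord0 c) => [a|] -> //.
by elim/ord3_ind: a.
Qed.

Lemma edge_label_sym u v a : edge_label u v a = edge_label v u a.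
Proof. by elim/ord4_ind: u; elim/ord4_ind: v; elim/ord3_ind: a. Qed.

Lemma edge_label_neq u v a : edge_label u v a -> u != v.
Proof. by case/andP. Qed.

Lemma edge_label_inj u v a b : edge_label u v a -> edge_label u v b -> a = b.
Proof.
by elim/ord4_ind: u; elim/ord4_ind: v; elim/ord3_ind: a; elim/ord3_ind: b.
Qed.

Lemma edge_label_functional u v w a :
  edge_label u v a -> edge_label u w a -> v = w.
Proof.
by elim/ord4_ind: u; elim/ord3_ind: a; elim/ord4_ind: v; elim/ord4_ind: w.
Qed.

Lemma edge_label_total u a : exists v, edge_label u v a.
Proof.
elim/ord4_ind: u; elim/ord3_ind: a; first
  [by exists ord0 | by exists (lift ord0 Left) | by exists (lift ord0 Right)
  | by exists (lift ord0 Bottom)].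
Qed.

Lemma edge_label_exists u v : u != v -> exists a, edge_label u v a.
Proof.
by elim/ord4_ind: u; elim/ord4_ind: v => // _; first
  [by exists Left | by exists Right | by exists Bottom].
Qed.

Lemma edge_label_triangle_uniq u v w a b c :
  edge_label u v a -> edge_label v w b -> edge_label w u c -> uniq [:: a; b; c].
Proof.
elim/ord4_ind: u; elim/ord4_ind: v; elim/ord3_ind: a => //;
by elim/ord4_ind: w; elim/ord3_ind: b => //; elim/ord3_ind: c.
Qed.

(** In the Klein four-group three distinct labels sum to zero, as do the differences around a
    triangle, so two correct sides force the third. *)
Lemma edge_label_triangle u v w a b c :
  edge_label u v a -> edge_label w u c -> uniq [:: a; b; c] -> edge_label v w b.
Proof.
elim/ord4_ind: u; elim/ord4_ind: v; elim/ord3_ind: a => //;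
by elim/ord4_ind: w; elim/ord3_ind: c => //; elim/ord3_ind: b.
Qed.

Section Colorings.
Variables (n : nat) (lam : 'I_3 -> n.+1.-tuple 'I_3).
Implicit Types (c : coloring n.+1) (P : {ffun edge n.+1 -> 'I_3}).
Implicit Type kappa : bcoloring n.+1.
Local Notation vtx := (mkc n.+1).

Lemma ends_mkc d x y : x + y <= n -> ends (d, mkc n x y) =
  if d == Left then (vtx x y, vtx x y.+1)
  else if d == Right then (vtx x y.+1, vtx x.+1 y)
  else (vtx x.+1 y, vtx x y).
Proof.
move=> xy; rewrite /ends /corner0 /cornerx /cornery !mkcE.
by rewrite xc_mkc // yc_mkc.
Qed.

Lemma bedgeE s i : i <= n -> bedge s (inord i : 'I_n.+1) =
  (s, if s == Left then mkc n 0 i else if s == Right then mkc n i (n - i)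
      else mkc n (n - i) 0).
Proof.
by move=> i_n; rewrite /bedge !mkcE /= inordK.
Qed.

Lemma ends_bedge s i : i <= n -> ends (bedge s (inord i : 'I_n.+1)) =
  if s == Left then (vtx 0 i, vtx 0 i.+1)
  else if s == Right then (vtx i (n - i).+1, vtx i.+1 (n - i))
  else (vtx (n - i).+1 0, vtx (n - i) 0).
Proof.
move=> i_n; have ir : i + (n - i) <= n by rewrite subnKC.
have ib : n - i + 0 <= n by rewrite addn0 leq_subr.
rewrite bedgeE //; elim/ord3_ind: s.
- exact: (ends_mkc Left (i_n : 0 + i <= n)).
- exact: (ends_mkc Right ir).
- exact: (ends_mkc Bottom ib).
Qed.

Definition boundary_labeled c : bool :=
  [forall s, forall i, edge_label (c (ends (bedge s i)).1) (c (ends (bedge s i)).2)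
                         (tnth (lam s) i)].

Definition mkbv v (bv : on_boundary v) : bvertex n.+1 :=
  exist (fun v : vertex n.+1 => on_boundary v) v bv.

Lemma bedge_on_boundary s (i : 'I_n.+1) :
  on_boundary (ends (bedge s i)).1 && on_boundary (ends (bedge s i)).2.
Proof.
have i_n : i <= n := ltn_ord i.
rewrite -(inord_val i) ends_bedge // /on_boundary.
by elim/ord3_ind: s; rewrite /= !xc_mkc ?yc_mkc //; lia.
Qed.

(** Walking clockwise from the base point, each color and the next edge label determine the next
    color. *)
Lemma is_col_unique kappa kappa' :
  is_col lam kappa -> is_col lam kappa' -> kappa = kappa'.
Proof.
case/andP=> /forallP base /forallP lab /andP[/forallP base' /forallP lab'].
pose agree v := forall u : bvertex n.+1, val u = v -> kappa u = kappa' u.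
have step s i : i <= n -> agree (ends (bedge s (inord i : 'I_n.+1))).1 ->
    agree (ends (bedge s (inord i : 'I_n.+1))).2.
  move=> i_n; have /andP[bu _] := bedge_on_boundary s (inord i).
  move=> /(_ (mkbv bu) erefl) eq_u v ev.
  have eE : ends (bedge s (inord i)) = (val (mkbv bu), val v).
    by rewrite ev -surjective_pairing.
  have := implyP (forallP (forallP (forallP (lab s) (inord i)) (mkbv bu)) v).
  have := implyP (forallP (forallP (forallP (lab' s) (inord i)) (mkbv bu)) v).
  rewrite eq_u => /(_ (introT eqP eE)) h' /(_ (introT eqP eE)) h.
  exact: edge_label_functional h h'.
have left y : y <= n.+1 -> agree (vtx 0 y).
  elim: y => [_ u eu|y IH yn].
    have eb : val u == base_point n.+1 by rewrite eu /base_point mkcE.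
    by rewrite (eqP (implyP (base u) eb)) (eqP (implyP (base' u) eb)).
  by have := step Left y yn; rewrite ends_bedge //=; apply; apply/IH/ltnW.
have right x : x <= n.+1 -> agree (vtx x (n.+1 - x)).
  elim: x => [_|x IH xn]; first by rewrite subn0; apply: left.
  have := step Right x xn; rewrite ends_bedge //= subSS; apply.
  by rewrite -subSn //; apply/IH/ltnW.
have bottom i : i <= n.+1 -> agree (vtx (n.+1 - i) 0).
  elim: i => [_|i IH i_n]; first by have := right n.+1 (leqnn _); rewrite subnn subn0.
  have := step Bottom i i_n; rewrite ends_bedge //= subSS; apply.
  by rewrite -subSn //; apply/IH/ltnW.
apply/ffunP=> v; have := valP v; have := cellP (val v); rewrite ltnS => vn.
have xn := leq_trans (leq_addr _ _) vn; have yn := leq_trans (leq_addl _ _) vn.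
case/or3P=> /eqP bv.
- by apply: (left (yc (val v))) => //; rewrite -[LHS]mkc_id bv.
- apply: (bottom (n.+1 - xc (val v))); first exact: leq_subr.
  by rewrite -[LHS]mkc_id bv; congr mkc; rewrite subKn.
- apply: (right (xc (val v))) => //.
  by rewrite -[LHS]mkc_id; congr mkc; rewrite -[LHS](addKn (xc (val v))) bv.
Qed.

(** The restriction of [c] to the boundary witnesses [is_col], so the choice in [col_map] succeeds,
    and by uniqueness it is that restriction. *)
Lemma coloringsP c : (c \in colorings (col_map lam)) =
  (c \in proper_colorings n.+1) && boundary_labeled c.
Proof.
apply/idP/andP.
  rewrite /col_map; case: pickP => [kappa|_]; last by rewrite inE.
  case/andP=> _ /forallP lab; rewrite !inE => /andP[-> /forallP agree]; split=> //.
  apply/forallP=> s; apply/forallP=> i; have /andP[bu bv] := bedge_on_boundary s i.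
  have := implyP (forallP (forallP (forallP (lab s) i) (mkbv bu)) (mkbv bv)).
  by rewrite -!(eqP (agree _)) -surjective_pairing eqxx; apply.
case=> pc bc; pose kappa : bcoloring n.+1 := [ffun v => c (val v)].
have kappaP : is_col lam kappa.
  apply/andP; split.
    apply/forallP=> v; apply/implyP=> /eqP ev; rewrite ffunE ev.
    by move: pc; rewrite inE => /andP[].
  apply/forallP=> s; apply/forallP=> i; apply/forallP=> u; apply/forallP=> v.
  apply/implyP=> /eqP e_uv; rewrite !ffunE.
  by have := forallP (forallP bc s) i; rewrite e_uv.
rewrite /col_map; case: pickP => [kappa'|/(_ kappa)]; last by rewrite kappaP.
move=> /(is_col_unique kappaP) <-; rewrite inE pc; apply/forallP=> v.
by rewrite ffunE.
Qed.

(** The default [Left] occurs only between equal colors, hence never for a proper coloring. *)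
Definition puzzle_of_coloring c : {ffun edge n.+1 -> 'I_3} :=
  [ffun e => odflt Left [pick a | edge_label (c (ends e).1) (c (ends e).2) a]].

Lemma puzzle_of_coloringP c e : c \in proper_colorings n.+1 ->
  edge_label (c (ends e).1) (c (ends e).2) (puzzle_of_coloring c e).
Proof.
rewrite inE => /andP[_ /forallP /(_ e) /edge_label_exists [a ea]].
by rewrite ffunE; case: pickP => [//|/(_ a)]; rewrite ea.
Qed.

Definition edges_labeled c P : Prop := forall x y, x + y <= n ->
  [/\ edge_label (c (vtx x y)) (c (vtx x y.+1)) (label P Left x y),
      edge_label (c (vtx x y.+1)) (c (vtx x.+1 y)) (label P Right x y)
    & edge_label (c (vtx x.+1 y)) (c (vtx x y)) (label P Bottom x y)].

Lemma edges_labeledP c P :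
  (forall e, edge_label (c (ends e).1) (c (ends e).2) (P e)) <-> edges_labeled c P.
Proof.
split=> [cP x y xy|cP [d f]].
  by split; [have := cP (Left, mkc n x y) | have := cP (Right, mkc n x y)
    | have := cP (Bottom, mkc n x y)]; rewrite ends_mkc.
have xy : xc f + yc f <= n := cellP f.
rewrite -(mkc_id f) ends_mkc //; have [] := cP _ _ xy.
by elim/ord3_ind: d.
Qed.

Lemma has_boundary_labeled c P :
    (forall e, edge_label (c (ends e).1) (c (ends e).2) (P e)) ->
  has_boundary lam P = boundary_labeled c.
Proof.
move=> cP; apply: eq_forallb => s; apply: eq_forallb => i.
apply/eqP/idP => [<- //|]; exact: edge_label_inj.
Qed.

Lemma puzzle_of_coloring_in c : c \in colorings (col_map lam) ->
  puzzle_of_coloring c \in puzzles123 lam.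
Proof.
rewrite coloringsP => /andP[pc bc]; have cP e := puzzle_of_coloringP e pc.
have /edges_labeledP lP := cP.
apply/puzzles123P; split; last by rewrite (has_boundary_labeled cP).
split=> x y xy.
  by have [l r b] := lP x y xy; apply: edge_label_triangle_uniq l r b.
have [l _ _] := lP x.+1 y xy; have [_ r _] := lP x y (ltnW xy).
have [|_ _ b] := lP x y.+1; first by rewrite addnS.
(* As oriented, the edges run around the down face in the order left, bottom, right; reversing all
   three gives the order of the face condition. *)
rewrite edge_label_sym in l; rewrite edge_label_sym in r; rewrite edge_label_sym in b.
exact: edge_label_triangle_uniq l r b.
Qed.

(** Labels determine the colors up the left side and then along each horizontal line, which reaches
    every vertex. *)
Lemma puzzle_of_coloring_inj :
  {in colorings (col_map lam) &, injective puzzle_of_coloring}.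
Proof.
move=> c c'; rewrite !coloringsP => /andP[pc _] /andP[pc' _] same.
have cP e := puzzle_of_coloringP e pc; have c'P e := puzzle_of_coloringP e pc'.
have /edges_labeledP lP := cP; have /edges_labeledP lP' := c'P.
rewrite -same in lP'.
have eqc0 y : y <= n.+1 -> c (vtx 0 y) = c' (vtx 0 y).
  elim: y => [_|y IH yn].
    move: pc pc'; rewrite !inE /base_point mkcE.
    by case/andP=> /eqP -> _ /andP[/eqP ->].
  have [l _ _] := lP 0 y yn; have [l' _ _] := lP' 0 y yn.
  by rewrite IH 1?ltnW // in l; apply: edge_label_functional l l'.
have eqc x y : x + y <= n.+1 -> c (vtx x y) = c' (vtx x y).
  elim: x => [|x IH] xy; first exact: eqc0.
  have [_ _ b] := lP x y xy; have [_ _ b'] := lP' x y xy.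
  rewrite edge_label_sym IH 1?ltnW // in b; rewrite edge_label_sym in b'.
  exact: edge_label_functional b b'.
by apply/ffunP=> v; rewrite -(mkc_id v) eqc //; exact: (cellP v).
Qed.

Definition neighbor u a : 'I_4 := xchoose (edge_label_total u a).

Lemma neighborP u a : edge_label u (neighbor u a) a.
Proof. exact: (xchooseP (edge_label_total u a)). Qed.

(** Integrates the labels along one path from the base point: up the left side, then
    horizontally. *)
Fixpoint color_at P x y : 'I_4 :=
  if x is x'.+1 then neighbor (color_at P x' y) (label P Bottom x' y)
  else iteri y (fun y' u => neighbor u (label P Left 0 y')) ord0.

Definition coloring_of_puzzle P : coloring n.+1 :=
  [ffun v => color_at P (xc v) (yc v)].

(** Horizontal edges and the left side are correct by construction. An up face passes correctness
    from its left to its right edge, and a down face from there to the left edge at the next x. *)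
Lemma puzzle_of_coloring_surj P : P \in puzzles123 lam ->
  exists2 c, c \in colorings (col_map lam) & puzzle_of_coloring c = P.
Proof.
move=> /puzzles123P[[up down] bP].
have bottom x y : edge_label (color_at P x.+1 y) (color_at P x y) (label P Bottom x y).
  by rewrite edge_label_sym neighborP.
have right_of_left x y : x + y <= n ->
    edge_label (color_at P x y) (color_at P x y.+1) (label P Left x y) ->
  edge_label (color_at P x y.+1) (color_at P x.+1 y) (label P Right x y).
  by move=> xy l; apply: edge_label_triangle l (bottom x y) (up x y xy).
have left x y : x + y <= n ->
    edge_label (color_at P x y) (color_at P x y.+1) (label P Left x y).
  elim: x => [|x IH] xy; first exact: neighborP.
  have r := right_of_left x y (ltnW xy) (IH (ltnW xy)).
  apply: edge_label_triangle r (bottom x y.+1) _.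
  by rewrite (uniq_catCA [:: _] [:: _] [:: _]); apply: down.
pose c := coloring_of_puzzle P.
have cE x y : x + y <= n.+1 -> c (vtx x y) = color_at P x y.
  by move=> xy; rewrite ffunE xc_mkc // yc_mkc.
have lP : edges_labeled c P.
  move=> x y xy; rewrite !cE ?addnS // ?leqW //.
  by split; [apply: left | apply/right_of_left/left | apply: bottom].
have cP := iffRL (edges_labeledP c P) lP.
have pc : c \in proper_colorings n.+1.
  rewrite inE /base_point mkcE cE //; apply/andP; split=> //.
  by apply/forallP=> e; apply: edge_label_neq (cP e).
exists c; first by rewrite coloringsP pc -(has_boundary_labeled cP).
apply/ffunP=> e; exact: edge_label_inj (puzzle_of_coloringP e pc) (cP e).
Qed.

Lemma colorings_puzzles123 :
  in_bijection (colorings (col_map lam)) (puzzles123 lam).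
Proof.
apply: in_bijectionP puzzle_of_coloring_in puzzle_of_coloring_inj _.
exact: puzzle_of_coloring_surj.
Qed.

End Colorings.

(** * Assembling the bijections *)

Theorem theorem1p2 (n : nat) (hn : 1 <= n) (lam : 'I_3 -> n.-tuple 'I_3) :
  [/\ in_bijection (interlacing_arrays lam) (puzzles123 lam),
      in_bijection (puzzles123 lam) (puzzles0110 (str_map lam))
    & in_bijection (puzzles0110 (str_map lam)) (colorings (col_map lam))].
Proof.
case: n hn lam => // n _ lam; split.
- exact: arrays_puzzles123.
- exact: puzzles123_0110.
apply/in_bijection_sym/(in_bijection_trans (colorings_puzzles123 lam)).
exact: puzzles123_0110.
Qed.
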